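(* Let $r_0>0$. Any $(1/600, r_0)$-Reifenberg-flat domain $\Omega\subseteq\mathbb{R}^N$ is a $(1/450, r_0/7)$-Jones-flat domain.
   Context: Notation: $B(x,r)$ is the open ball of radius $r$ centered at $x$ in $\mathbb{R}^N$; $d(x,y)=|x-y|$; $d(x,A)$ is the distance from the point $x$ to the set $A$; $\Omega^c=\mathbb{R}^N\setminus\Omega$; $\mathcal{H}^1$ is the one-dimensional Hausdorff measure. The Hausdorff distance between two sets is $d_H(X,Y)=\max\{\sup_{x\in X}d(x,Y),\ \sup_{y\in Y}d(y,X)\}$. Reifenberg-flat domain: let $0<\varepsilon<1/2$ and $r_0>0$. An $(\varepsilon,r_0)$-Reifenberg-flat domain $\Omega\subseteq\mathbb{R}^N$ is a nonempty open set satisfying the following two conditions: (i) for every $x\in\partial\Omega$ and every $0<r\le r_0$ there is a hyperplane $P(x,r)$ containing $x$ which satisfies $\frac1r d_H\big(\partial\Omega\cap B(x,r),P(x,r)\cap B(x,r)\big)\le\varepsilon$; (ii) for every $x\in\partial\Omega$, one of the connected components of $B(x,r_0)\cap\{y: d(y,P(x,r_0))\ge 2\varepsilon r_0\}$ is contained in $\Omega$ and the other one is contained in $\mathbb{R}^N\setminus\Omega$. Jones-flat domain: an open and bounded set $\Omega$ is a $(\delta,R_0)$-Jones-flat domain if for any $x,y\in\Omega$ such that $d(x,y)\le R_0$ there is a rectifiable curve $\gamma$ which connects $x$ and $y$ and satisfies $\mathcal{H}^1(\gamma)\le\delta^{-1}d(x,y)$ and $d(z,\Omega^c)\ge\delta\,\frac{d(z,x)\,d(z,y)}{d(x,y)}$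 for all $z\in\gamma$.
   Formalization: A Reifenberg-flat domain need not be bounded (e.g. a half-space), while Jones-flat sets must be; so Jones-flatness is proved for bounded domains, and the curve condition of the Jones definition is proved for all Reifenberg-flat domains, bounded or not. *)

(* Defs.v *)
From mathcomp Require Import all_boot all_order all_algebra.
From mathcomp Require Import all_classical all_reals all_analysis.

Set Implicit Arguments.
Unset Strict Implicit.
Unset Printing Implicit Defensive.

Import Order.TTheory GRing.Theory Num.Theory.
Import numFieldNormedType.Exports.

Local Open Scope classical_set_scope.
Local Open Scope ring_scope.

(* R^N is 'rV[R]_N.  The library norm on 'rV[R]_N is the sup norm, so the
   Euclidean metric is defined separately.  The library topology is still used
   for open, closure, connected_component, continuity (and the library norm for
   bounded_set): both norms induce the same topology and bounded sets. *)
Section Euclidean.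
Variables (R : realType) (N : nat).
Local Notation pt := 'rV[R]_N.
Implicit Types (x y : pt) (A X Y : set pt).

Definition dotv x y : R := \sum_(i < N) x 0 i * y 0 i.

Definition eucl_norm x : R := Num.sqrt (dotv x x).

Definition eucl_dist x y : R := eucl_norm (x - y).

Definition eucl_ball x (r : R) : set pt := [set y | eucl_dist x y < r].

(* The distance to the empty set is +oo. *)
Definition dist_set x A : \bar R := ereal_inf [set (eucl_dist x a)%:E | a in A].

Definition hausdorff_dist X Y : \bar R :=
  maxe (ereal_sup [set dist_set x Y | x in X])
       (ereal_sup [set dist_set y X | y in Y]).

Definition boundary A : set pt := closure A `\` interior A.

Definition hyperplane A :=
  exists (v : pt) (c : R), v != 0 /\ A = [set y | dotv v y = c].

Definition components A : set (set pt) :=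
  [set connected_component A x | x in A].

(* The singleton [set 0] makes the diameter of the empty set equal to 0. *)
Definition diam A : \bar R :=
  ereal_sup ([set 0%E] `|` [set (eucl_dist p.1 p.2)%:E | p in A `*` A]).

Definition hausdorff1_pre (d : R) A : \bar R :=
  ereal_inf [set (\sum_(0 <= k <oo) diam (U k))%E | U in
    [set U : nat -> set pt |
      A `<=` \bigcup_k U k /\ forall k, (diam (U k) <= d%:E)%E]].

Definition hausdorff1 A : \bar R :=
  ereal_sup [set hausdorff1_pre d A | d in [set d : R | 0 < d]].

(* itv_partition a b s : a < s_0 < ... < s_(n-1) = b *)
Definition curve_length (a b : R) (g : R -> pt) : \bar R :=
  ereal_sup [set (\sum_(0 <= k < size s)
      eucl_dist (g (nth b (a :: s) k)) (g (nth b (a :: s) k.+1)))%:E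
    | s in itv_partition a b].

(* A curve is the image of a continuous parametrization. *)
Definition rectifiable_curve_between x y (gamma : set pt) :=
  exists g : R -> pt,
    [/\ {within `[0, 1], continuous g}, g 0 = x, g 1 = y,
        (curve_length 0 1 g < +oo)%E & gamma = g @` `[0, 1]].

(* P x r is a choice of hyperplane in the first condition; the second condition
   refers to this choice at scale r0. *)
Definition Reifenberg_flat (eps r0 : R) (Omega : set pt) :=
  [/\ 0 < eps < 2^-1, 0 < r0, Omega !=set0, open Omega &
    exists P : pt -> R -> set pt,
      (forall x r, boundary Omega x -> 0 < r <= r0 ->
        [/\ hyperplane (P x r), P x r x &
            ((r^-1)%:E * hausdorff_dist (boundary Omega `&` eucl_ball x r)
                                        (P x r `&` eucl_ball x r)
              <= eps%:E)%E]) /\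
      (forall x, boundary Omega x ->
        exists C1 C2 : set pt,
          [/\ C1 <> C2,
              components (eucl_ball x r0 `&`
                [set y | ((2 * eps * r0)%:E <= dist_set y (P x r0))%E])
                = [set C1; C2],
              C1 `<=` Omega & C2 `<=` ~` Omega])].

(* For x = y the quotient is 0 (division by 0 yields 0), and the constant curve
   satisfies the requirement. *)
Definition Jones_curve_condition (delta R0 : R) (Omega : set pt) :=
  forall x y, Omega x -> Omega y -> eucl_dist x y <= R0 ->
    exists gamma : set pt,
      [/\ rectifiable_curve_between x y gamma,
          (hausdorff1 gamma <= (delta^-1 * eucl_dist x y)%:E)%E &
          forall z, gamma z ->
            ((delta * (eucl_dist z x * eucl_dist z y / eucl_dist x y))%:E
              <= dist_set z (~` Omega))%E].

Definition Jones_flat (delta R0 : R) (Omega : set pt) :=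
  [/\ open Omega, bounded_set Omega & Jones_curve_condition delta R0 Omega].

End Euclidean.

(* Main.v *)
(** Flatness and a connectedness argument propagate the separation condition
    from scale [r0] to every smaller scale: near a boundary point [q], at every
    scale [r <= r0], one half ball beyond height [r / 300] over the
    approximating hyperplane lies in [Omega] and the opposite one outside.
    Let [D := |x - y|].  If [x] or [y] is at distance at least [11/10 D] from
    the complement, the segment works.  Otherwise, take a nearly closest
    boundary point [q] of [x] and climb from [x] through points at height about
    [r / 2] over [q] for the scales [r = s, 2s, 4s, ...] until [r] is comparable
    to [D].  Each step stays in a half ball at scale [2r], hence at distance at
    least [2/5 r] from the complement, and the lengths form a geometric
    progression.  Do the same from [y]; both end points lie on the inner side
    of the same hyperplane at scale [7 D <= r0], so the segment between them is
    far from the complement. *)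

Require Import Defs.
From mathcomp Require Import all_boot all_order all_algebra.
From mathcomp Require Import all_classical all_reals all_analysis.
From mathcomp Require Import ring lra.

Set Implicit Arguments.
Unset Strict Implicit.
Unset Printing Implicit Defensive.

Import Order.TTheory GRing.Theory Num.Theory.
Import numFieldNormedType.Exports.

Local Open Scope classical_set_scope.
Local Open Scope ring_scope.

(** * Euclidean inner product, norm and distance *)

Section EuclideanSpace.
Variables (R : realType) (N : nat).
Local Notation pt := 'rV[R]_N.
Implicit Types (x y z u v : pt) (a : R).

Lemma dotvC x y : dotv x y = dotv y x.
Proof. by apply: eq_bigr => i _; rewrite mulrC. Qed.

Lemma dotvDl x y z : dotv (x + y) z = dotv x z + dotv y z.
Proof. by rewrite -big_split; apply: eq_bigr => i _; rewrite mxE mulrDl. Qed.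

Lemma dotvZl a x y : dotv (a *: x) y = a * dotv x y.
Proof. by rewrite mulr_sumr; apply: eq_bigr => i _; rewrite mxE mulrA. Qed.

Lemma dotvNl x y : dotv (- x) y = - dotv x y.
Proof. by rewrite -scaleN1r dotvZl mulN1r. Qed.

Lemma dotvBl x y z : dotv (x - y) z = dotv x z - dotv y z.
Proof. by rewrite dotvDl dotvNl. Qed.

Lemma dotvDr x y z : dotv z (x + y) = dotv z x + dotv z y.
Proof. by rewrite !(dotvC z) dotvDl. Qed.

Lemma dotvZr a x y : dotv y (a *: x) = a * dotv y x.
Proof. by rewrite !(dotvC y) dotvZl. Qed.

Lemma dotvNr x y : dotv x (- y) = - dotv x y.
Proof. by rewrite !(dotvC x) dotvNl. Qed.

Lemma dotvBr x y z : dotv z (x - y) = dotv z x - dotv z y.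
Proof. by rewrite !(dotvC z) dotvBl. Qed.

Lemma dotv_ge0 x : 0 <= dotv x x.
Proof. by apply: sumr_ge0 => i _; rewrite -expr2 sqr_ge0. Qed.

Lemma eucl_norm_ge0 x : 0 <= eucl_norm x.
Proof. exact: sqrtr_ge0. Qed.

Lemma sqr_eucl_norm x : eucl_norm x ^+ 2 = dotv x x.
Proof. exact/sqr_sqrtr/dotv_ge0. Qed.

Lemma eucl_normE x a : 0 <= a -> dotv x x = a ^+ 2 -> eucl_norm x = a.
Proof. by move=> a0 xa; rewrite /eucl_norm xa sqrtr_sqr ger0_norm. Qed.

Lemma eucl_normZ a x : eucl_norm (a *: x) = `|a| * eucl_norm x.
Proof.
rewrite /eucl_norm dotvZl dotvZr mulrA -expr2 sqrtrM ?sqr_ge0//.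
by rewrite sqrtr_sqr.
Qed.

Lemma eucl_normN x : eucl_norm (- x) = eucl_norm x.
Proof. by rewrite -scaleN1r eucl_normZ normrN1 mul1r. Qed.

Lemma coord_le_eucl_norm x (i : 'I_N) : `|x 0 i| <= eucl_norm x.
Proof.
rewrite -sqrtr_sqr ler_wsqrtr// /dotv (bigD1 i)//= -expr2 lerDl.
by apply: sumr_ge0 => j _; rewrite -expr2 sqr_ge0.
Qed.

Lemma eucl_norm0_eq0 x : eucl_norm x = 0 -> x = 0.
Proof.
move=> x0; apply/rowP => i; rewrite mxE; apply/eqP.
by rewrite -normr_le0 -x0 coord_le_eucl_norm.
Qed.

(** Cauchy-Schwarz: with [m], [n] the norms of [x], [y], the square of the norm of [n *: x - m *: y]
    is [2 * m * n * (m * n - dotv x y)], and [m * n] can be cancelled unless [x] or [y] vanishes. *)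
Lemma dotv_le x y : dotv x y <= eucl_norm x * eucl_norm y.
Proof.
set m := eucl_norm x; set n := eucl_norm y.
have m0 : 0 <= m := eucl_norm_ge0 x.
have n0 : 0 <= n := eucl_norm_ge0 y.
have := dotv_ge0 (n *: x - m *: y).
rewrite !(dotvBl, dotvBr, dotvZl, dotvZr) -!sqr_eucl_norm -/m -/n (dotvC y x).
have [mE|mN] := eqVneq m 0.
  by move: (eucl_norm0_eq0 mE) => ->; rewrite -(scale0r y) dotvZl !mul0r mulr_ge0.
have [nE|nN] := eqVneq n 0.
  by move: (eucl_norm0_eq0 nE) => ->; rewrite -(scale0r x) dotvZr !mul0r mulr_ge0.
have mn0 : 0 < m * n by rewrite mulr_gt0// lt_neqAle eq_sym ?mN ?nN.
move=> H; rewrite -(ler_pM2l mn0).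
nra.
Qed.

Lemma normr_dotv_le x y : `|dotv x y| <= eucl_norm x * eucl_norm y.
Proof.
rewrite ler_norml dotv_le andbT lerNl -dotvNl.
by rewrite (le_trans (dotv_le _ _))// eucl_normN.
Qed.

Lemma eucl_normD x y : eucl_norm (x + y) <= eucl_norm x + eucl_norm y.
Proof.
rewrite -(@ler_pXn2r _ 2)// ?nnegrE ?addr_ge0 ?eucl_norm_ge0//.
rewrite sqr_eucl_norm dotvDl !dotvDr (dotvC y x).
have := dotv_le x y; have := sqr_eucl_norm x; have := sqr_eucl_norm y.
nra.
Qed.

Lemma eucl_dist_ge0 x y : 0 <= eucl_dist x y.
Proof. exact: eucl_norm_ge0. Qed.

Lemma eucl_dist_sym x y : eucl_dist x y = eucl_dist y x.
Proof. by rewrite /eucl_dist -eucl_normN opprB. Qed.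

Lemma eucl_dist_triangle y x z :
  eucl_dist x z <= eucl_dist x y + eucl_dist y z.
Proof.
by rewrite /eucl_dist (le_trans _ (eucl_normD _ _))// addrA subrK.
Qed.

Lemma eucl_distxx x : eucl_dist x x = 0.
Proof. by rewrite /eucl_dist subrr -(scale0r 0) eucl_normZ normr0 mul0r. Qed.

Lemma eucl_dist0_eq x y : eucl_dist x y = 0 -> x = y.
Proof. by move/eucl_norm0_eq0/eqP; rewrite subr_eq0 => /eqP. Qed.

Lemma eucl_distDl x u v : eucl_dist (x + u) (x + v) = eucl_dist u v.
Proof. by rewrite /eucl_dist opprD addrACA subrr add0r. Qed.

Lemma eucl_distDr0 x u : eucl_dist (x + u) x = eucl_norm u.
Proof. by rewrite /eucl_dist addrAC subrr add0r. Qed.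

(** * Segments and convexity *)

Definition line x y (t : R) : pt := x + t *: (y - x).

Lemma line0 x y : line x y 0 = x.
Proof. by rewrite /line scale0r addr0. Qed.

Lemma line1 x y : line x y 1 = y.
Proof. by rewrite /line scale1r addrC subrK. Qed.

Lemma eucl_dist_line x y s t :
  eucl_dist (line x y s) (line x y t) = `|s - t| * eucl_dist x y.
Proof.
rewrite /line eucl_distDl /eucl_dist -scalerBl eucl_normZ.
by rewrite -(eucl_normN (y - x)) opprB.
Qed.

Lemma eucl_dist_line_le x y z t B : 0 <= t <= 1 ->
  eucl_dist x z <= B -> eucl_dist y z <= B -> eucl_dist (line x y t) z <= B.
Proof.
move=> /andP[t0 t1] xB yB.
have -> : eucl_dist (line x y t) z =
    eucl_norm ((1 - t) *: (x - z) + t *: (y - z)).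
  by congr eucl_norm; apply/rowP => i; rewrite !mxE; ring.
apply: le_trans (eucl_normD _ _) _; rewrite !eucl_normZ !ger0_norm ?subr_ge0//.
have : (1 - t) * eucl_dist x z <= (1 - t) * B by rewrite ler_wpM2l ?subr_ge0.
have : t * eucl_dist y z <= t * B by rewrite ler_wpM2l.
by rewrite /eucl_dist; nra.
Qed.

Lemma eucl_dist_line_lt x y z t B : 0 <= t <= 1 ->
  eucl_dist x z < B -> eucl_dist y z < B -> eucl_dist (line x y t) z < B.
Proof.
move=> t01 xB yB; apply: (@le_lt_trans _ _ (Num.max (eucl_dist x z) (eucl_dist y z))).
  by apply: eucl_dist_line_le; rewrite // le_max lexx ?orbT.
by rewrite gt_max xB.
Qed.

Lemma dotv_line_ge x y q nu t h : 0 <= t <= 1 ->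
  h <= dotv (x - q) nu -> h <= dotv (y - q) nu -> h <= dotv (line x y t - q) nu.
Proof.
move=> /andP[t0 t1] xh yh.
have -> : line x y t - q = (1 - t) *: (x - q) + t *: (y - q).
  by apply/rowP => i; rewrite !mxE; ring.
rewrite dotvDl !dotvZl.
have : (1 - t) * h <= (1 - t) * dotv (x - q) nu by rewrite ler_wpM2l ?subr_ge0.
have : t * h <= t * dotv (y - q) nu by rewrite ler_wpM2l.
nra.
Qed.

(** * Topology: continuity, connectedness and boundary crossings *)

Lemma ball_eucl x y e : 0 < e -> eucl_dist x y < e -> ball x e y.
Proof.
move=> e0 xy; split => // i j; rewrite ord1 -ball_normE /ball_/=.
apply: le_lt_trans xy; rewrite /eucl_dist.
by have := coord_le_eucl_norm (x - y) j; rewrite !mxE.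
Qed.

Lemma open_eucl_ball (U : set pt) x : open U -> U x ->
  exists2 e : R, 0 < e & forall y, eucl_dist x y < e -> U y.
Proof.
rewrite openE => oU /oU /nbhs_ballP[e /= e0 eU].
by exists e => // y xy; apply/eU/ball_eucl.
Qed.

Lemma lipschitz_continuous (f : R -> pt) (L : R) (A : set R) : 0 <= L ->
  (forall s t, A s -> A t -> eucl_dist (f s) (f t) <= L * `|s - t|) ->
  {within A, continuous f}.
Proof.
move=> L0 fL; apply/subspace_continuousP => s As.
apply/cvg_ballP => e e0; rewrite near_withinE near_simpl.
have L1 : 0 < L + 1 by rewrite ltr_wpDl.
near=> t => At; apply: ball_eucl => //.
apply: le_lt_trans (fL _ _ As At) _.
have st : `|s - t| < e / (L + 1).
  near: t; apply/nbhs_ballP; exists (e / (L + 1)); first exact: divr_gt0.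
  by move=> t; rewrite -ball_normE.
rewrite ltr_pdivlMr// in st.
have := normr_ge0 (s - t); nra.
Unshelve. all: by end_near. Qed.

Lemma segment_line_connected x y : connected (line x y @` `[0, 1]).
Proof.
apply: connected_continuous_connected (@segment_connected R 0 1) _.
apply: (@lipschitz_continuous _ (eucl_dist x y)); first exact: eucl_dist_ge0.
by move=> s t _ _; rewrite eucl_dist_line mulrC.
Qed.

(** If [C] missed the boundary, its traces on the interior and on the closure of [U] would coincide,
    giving a nonempty clopen part of [C] that omits [y]. *)
Lemma connected_meets_boundary (C U : set pt) x y : connected C ->
  C x -> U x -> C y -> ~ U y -> exists2 p, C p & boundary U p.
Proof.
move=> conn Cx Ux Cy nUy; apply: contrapT => noB.
have sub p : C p -> closure U p -> interior U p.
  by move=> Cp clp; apply: contrapT => nint; apply: noB; exists p.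
have : C `&` interior U = C.
  apply: conn.
  - by exists x; split => //; apply: sub => //; exact: subset_closure.
  - by exists (interior U) => //; exact: open_interior.
  - exists (closure U); first exact: closed_closure.
    apply/seteqP; split=> p [Cp Up]; split => //.
      by apply: subset_closure; apply: interior_subset.
    exact: sub.
by move=> /seteqP[_ /(_ y Cy)[_ /interior_subset]].
Qed.

Lemma segment_meets_boundary (U : set pt) x y : U x -> ~ U y ->
  exists2 t, 0 <= t <= 1 & boundary U (line x y t).
Proof.
move=> Ux nUy.
have [||p [t] + <- bp] :=
    connected_meets_boundary (@segment_line_connected x y) _ Ux _ nUy.
- by exists 0; rewrite ?line0//= in_itv/= lexx ler01.
- by exists 1; rewrite ?line1//= in_itv/= lexx ler01.
- by rewrite /= in_itv/= => t01; exists t.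
Qed.

Lemma open_boundaryN (U : set pt) p : open U -> boundary U p -> ~ U p.
Proof. by move=> /interior_id oU [_]; rewrite oU. Qed.

(** * 1-Lipschitz paths and their concatenation *)

(* Parametrizing by [0, L] rather than [0, 1] makes concatenation work without
   rescaling, also for L = 0. *)
Definition lip_path (Q : pt -> Prop) (L : R) x y : Prop := 0 <= L /\
  exists g : R -> pt, [/\ g 0 = x, g L = y,
    (forall s t : R, 0 <= s -> s <= t -> t <= L -> eucl_dist (g s) (g t) <= t - s) &
    (forall t : R, 0 <= t -> t <= L -> Q (g t))].

Lemma lip_path_sub (Q Q' : pt -> Prop) L x y :
  (forall z, Q z -> Q' z) -> lip_path Q L x y -> lip_path Q' L x y.
Proof.
by move=> QQ' [L0 [g [g0 gL gl gQ]]]; split=> //; exists g; split=> // *; exact/QQ'/gQ.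
Qed.

Lemma lip_path_cat (Q : pt -> Prop) L L' x y z :
  lip_path Q L x y -> lip_path Q L' y z -> lip_path Q (L + L') x z.
Proof.
move=> [L0 [g [g0 gL gl gQ]]] [L'0 [h [h0 hL hl hQ]]].
split; first exact: addr_ge0.
exists (fun t => if t <= L then g t else h (t - L)); split.
- by rewrite L0.
(* The end time [L + L'] falls into the first branch only when [L' = 0], and then [h] starts and
   ends at the same point. *)
- case: ifPn => [le|_]; last by rewrite addrAC subrr add0r.
  have L'E : L' = 0 by lra.
  by rewrite L'E addr0 gL -h0 -[in LHS]L'E.
- move=> s t s0 st tL; case: ifPn => sL; case: ifPn => tL'.
  + exact: gl.
  + rewrite -ltNge in tL'; apply: le_trans (eucl_dist_triangle y _ _) _.
    have : eucl_dist (g s) y <= L - s by rewrite -gL gl.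
    have : eucl_dist y (h (t - L)) <= t - L - 0 by rewrite -h0 hl//; lra.
    lra.
  + by exfalso; lra.
  + rewrite -ltNge in sL.
    have : eucl_dist (h (s - L)) (h (t - L)) <= t - L - (s - L) by apply: hl; lra.
    lra.
- move=> t t0 tL; case: ifPn => tL'; first exact: gQ.
  by rewrite -ltNge in tL'; apply: hQ; lra.
Qed.

Lemma lip_path_rev (Q : pt -> Prop) L x y :
  lip_path Q L x y -> lip_path Q L y x.
Proof.
move=> [L0 [g [g0 gL gl gQ]]]; split=> //; exists (fun t => g (L - t)); split.
- by rewrite subr0.
- by rewrite subrr.
- move=> s t s0 st tL; rewrite eucl_dist_sym.
  have : eucl_dist (g (L - t)) (g (L - s)) <= L - s - (L - t) by apply: gl; lra.
  lra.
- by move=> t t0 tL; apply: gQ; lra.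
Qed.

Lemma lip_path_line (Q : pt -> Prop) x y :
  (forall t, 0 <= t <= 1 -> Q (line x y t)) ->
  lip_path Q (eucl_dist x y) x y.
Proof.
move=> lQ; split; first exact: eucl_dist_ge0.
have [xy0|xyN0] := eqVneq (eucl_dist x y) 0.
  rewrite xy0 -(eucl_dist0_eq xy0); exists (fun=> x); split => //.
  - by move=> s t s0 st t0; rewrite eucl_distxx; lra.
  - by move=> t _ _; have := lQ 0; rewrite line0 lexx ler01; apply.
have xy0 : 0 < eucl_dist x y by rewrite lt_neqAle eq_sym xyN0 eucl_dist_ge0.
exists (fun t => line x y (t / eucl_dist x y)); split.
- by rewrite mul0r line0.
- by rewrite divff// line1.
- move=> s t s0 st tL; rewrite eucl_dist_line -mulrBl normrM.
  rewrite (ger0_norm (_ : 0 <= (eucl_dist x y)^-1)) ?invr_ge0 ?eucl_dist_ge0//.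
  by rewrite -mulrA mulVf// mulr1 distrC ger0_norm ?subr_ge0.
- move=> t t0 tL; apply: lQ.
  by rewrite divr_ge0 ?(ltW xy0)//= ler_pdivrMr// mul1r.
Qed.

(** The path rests at its end point during the extra time, so that length bounds may be rounded
    up. *)
Lemma lip_path_widen (Q : pt -> Prop) L L' x y :
  L <= L' -> lip_path Q L x y -> lip_path Q L' x y.
Proof.
move=> LL' pxy; have [L0 [g [_ gL _ gQ]]] := pxy.
rewrite -(subrKC L L'); apply: lip_path_cat pxy _.
split; first by rewrite subr_ge0.
exists (fun=> y); split => //.
- by move=> s t s0 st t0; rewrite eucl_distxx; lra.
- by move=> t _ _; rewrite -gL; exact: gQ.
Qed.

(** * Length and one-dimensional measure of Lipschitz curves *)

Lemma diam_le (A : set pt) (M : R) : 0 <= M ->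
  (forall x y, A x -> A y -> eucl_dist x y <= M) -> (diam A <= M%:E)%E.
Proof.
move=> M0 AM; apply: ge_ereal_sup => _ [->|[[x y] [/= Ax Ay] <-]].
  by rewrite lee_fin.
by rewrite lee_fin; exact: AM.
Qed.

Lemma diam_ge0 (A : set pt) : (0 <= diam A)%E.
Proof. by apply: ereal_sup_ubound; left. Qed.

Section LipschitzCurve.
Variables (f : R -> pt) (L : R).
Hypotheses (L0 : 0 <= L) (fL : forall s t, 0 <= s -> s <= t -> t <= 1 ->
  eucl_dist (f s) (f t) <= L * (t - s)).

Lemma curve_length_lipschitz : (curve_length 0 1 f <= L%:E)%E.
Proof.
apply: ge_ereal_sup => _ [s sP <-]; rewrite lee_fin.
have -> : L = \sum_(0 <= k < size s)
    L * (nth 1 (0 :: s) k.+1 - nth 1 (0 :: s) k).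
  rewrite -mulr_sumr telescope_sumr// (itv_partition_nth_size _ sP)/=.
  by rewrite subr0 mulr1.
rewrite !big_nat; apply: ler_sum => k /andP[_ ks].
apply: fL.
- by apply: itv_partition_nth_ge sP; rewrite ltnW.
- by have := @nondecreasing_fun_itv_partition _ _ 0 1 (@id R) s _ sP; apply.
- exact: itv_partition_nth_le sP.
Qed.

(** The images of [n] equal subintervals have diameter at most [L / n]; for [n] large this is at
    most [d], and the sum over the cover is at most [L] whatever [d] is. *)
Lemma hausdorff1_lipschitz : (hausdorff1 (f @` `[0%R, 1%R]) <= L%:E)%E.
Proof.
apply: ge_ereal_sup => _ [d /= d0 <-].
(* The successor guarantees that [n] is positive. *)
pose n := (Num.bound (L / d)).+1.
have n0 : 0 < n%:R :> R by rewrite ltr0n.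
have Lnd : L / n%:R <= d.
  rewrite ler_pdivrMr// mulrC -ler_pdivrMr//.
  apply: le_trans (ltW (archi_boundP _)) _; first by rewrite divr_ge0// ltW.
  by rewrite ler_nat.
pose U k : set pt := if (k < n)%N
  then f @` `[k%:R / n%:R, k.+1%:R / n%:R] else set0.
have diamU k : (diam (U k) <= (if (k < n)%N then L / n%:R else 0)%:E)%E.
  apply: diam_le; first by case: ifP => // _; rewrite divr_ge0// ltW.
  rewrite /U; case: ifP => // kn _ _ [s + <-] [t + <-].
  rewrite /= !in_itv/= => /andP[ks sk] /andP[kt tk].
  wlog st : s t ks sk kt tk / s <= t.
    move=> wl; have [/wl|/ltW/wl] := leP s t; first exact.
    by rewrite eucl_dist_sym; exact.
  have k0 : 0 <= k%:R / n%:R :> R by rewrite divr_ge0.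
  have k1 : k.+1%:R / n%:R <= 1 :> R by rewrite ler_pdivrMr// mul1r ler_nat.
  apply: le_trans (fL _ st _) _; [lra|lra|].
  rewrite ler_wpM2l//.
  have : k.+1%:R / n%:R = k%:R / n%:R + n%:R^-1 :> R.
    by rewrite -natr1 mulrDl mul1r.
  lra.
apply: (@le_trans _ _ (\sum_(0 <= k <oo) diam (U k))%E).
  apply: ereal_inf_lbound; exists U => //; split.
  - move=> _ [t + <-]; rewrite /= in_itv/= => /andP[t0 t1].
    have ex : exists k, t <= k.+1%:R / n%:R.
      by exists n.-1; rewrite divff// lt0r_neq0.
    (* By minimality of [k], the point [t] is not below the left end of piece [k]. *)
    case: (ex_minnP ex) => k tk kmin.
    have kn : (k < n)%N by rewrite ltnS kmin// divff// lt0r_neq0.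
    exists k => //; rewrite /U kn; exists t => //.
    rewrite /= in_itv/= tk andbT.
    case: k kmin {tk kn} => [|k] kmin; first by rewrite mul0r.
    by rewrite leNgt; apply/negP => /ltW/kmin; rewrite ltnn.
  - move=> k; apply: le_trans (diamU k) _; rewrite lee_fin.
    by case: ifP => // _; exact: ltW.
rewrite (nneseries_split 0 n) => [|k _]; last exact: diam_ge0.
rewrite add0n eseries0 ?adde0; last first.
  move=> k nk _; apply/eqP; rewrite eq_le diam_ge0 andbT.
  by apply: le_trans (diamU k) _; rewrite ltnNge nk.
apply: (@le_trans _ _ (\sum_(0 <= k < n) (L / n%:R)%:E)%E).
  rewrite !big_nat; apply: lee_sum => k /andP[_ kn].
  by have := diamU k; rewrite kn.
rewrite sumEFin lee_fin sumr_const_nat subn0 -[_ *+ n]mulr_natr divfK//.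
exact: lt0r_neq0.
Qed.

End LipschitzCurve.

(** Rescaling time by [L] turns the path into an [L]-Lipschitz curve on the unit interval. *)
Lemma lip_path_rectifiable (Q : pt -> Prop) L x y : lip_path Q L x y ->
  exists gamma : set pt, [/\ rectifiable_curve_between x y gamma,
    (hausdorff1 gamma <= L%:E)%E & forall z, gamma z -> Q z].
Proof.
move=> [L0 [g [g0 gL gl gQ]]].
pose f t := g (L * t).
have fL s t : 0 <= s -> s <= t -> t <= 1 ->
    eucl_dist (f s) (f t) <= L * (t - s).
  move=> s0 st t1; rewrite mulrBr; apply: gl.
  - exact: mulr_ge0.
  - exact: ler_wpM2l.
  - by rewrite -[leRHS]mulr1 ler_wpM2l.
exists (f @` `[0, 1]); split.
- exists f; split => //; rewrite /f ?mulr0 ?mulr1//.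
  + apply: (@lipschitz_continuous _ L) => // s t.
    rewrite /= !in_itv/= => /andP[s0 s1] /andP[t0 t1].
    have [st|/ltW ts] := leP s t.
      by rewrite distrC ger0_norm ?subr_ge0// fL.
    by rewrite eucl_dist_sym ger0_norm ?subr_ge0// fL.
  + by apply: le_lt_trans (curve_length_lipschitz fL) _; rewrite ltry.
- exact: hausdorff1_lipschitz.
- move=> _ [t + <-]; rewrite /= in_itv/= => /andP[t0 t1]; apply: gQ.
  + exact: mulr_ge0.
  + by rewrite -[leRHS]mulr1 ler_wpM2l.
Qed.

End EuclideanSpace.

(** * Flatness and separation at one scale *)

Section ReifenbergFlat.
Variables (R : realType) (N : nat).
Local Notation pt := 'rV[R]_N.
Implicit Types (Om : set pt) (a p q w x y z nu : pt) (r : R).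

(** A lower bound for the distance to the complement, stated without an extended-real infimum. *)
Definition clearance Om z (c : R) := forall a, ~ Om a -> c <= eucl_dist z a.

(** Condition (i) at scale [r] in terms of a unit normal [nu]. The second bound is doubled to
    [r / 300] because the infimum defining the distance to the boundary need not be attained. *)
Definition flat_normal Om q r nu :=
  [/\ dotv nu nu = 1,
    (forall p, boundary Om p -> eucl_dist p q < r ->
      `|dotv (p - q) nu| <= r / 600) &
    (forall w, eucl_dist w q < r -> dotv (w - q) nu = 0 ->
      exists2 p, boundary Om p & eucl_dist p w <= r / 300)].

(** Condition (ii) at scale [r], oriented so that [nu] points into [Om]; the threshold [r / 300] is
    [2 * eps * r] for [eps = 1 / 600]. *)
Definition two_sided Om q r nu :=
  [/\ flat_normal Om q r nu,
    (forall z, eucl_dist z q < r -> r / 300 <= dotv (z - q) nu -> Om z) &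
    (forall z, eucl_dist z q < r -> dotv (z - q) nu <= - (r / 300) -> ~ Om z)].

Lemma unit_normal_norm nu : dotv nu nu = 1 -> eucl_norm nu = 1.
Proof. by move=> nu1; apply: eucl_normE; rewrite ?expr1n. Qed.

Lemma dotv_unit_le z w nu : dotv nu nu = 1 ->
  `|dotv (z - w) nu| <= eucl_dist z w.
Proof.
move=> /unit_normal_norm nu1.
by apply: le_trans (normr_dotv_le _ _) _; rewrite nu1 mulr1.
Qed.

Lemma orthogonal_projection z q nu : dotv nu nu = 1 ->
  let w := z - dotv (z - q) nu *: nu in
  [/\ dotv (w - q) nu = 0, eucl_dist w q <= eucl_dist z q &
      eucl_dist w z = `|dotv (z - q) nu|].
Proof.
move=> nu1 w; set h := dotv (z - q) nu in w *.
have wq : w - q = (z - q) - h *: nu by rewrite /w addrAC.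
split.
- by rewrite wq dotvBl dotvZl nu1 mulr1 subrr.
- rewrite /eucl_dist -(@ler_pXn2r _ 2)// ?nnegrE ?eucl_norm_ge0//.
  rewrite !sqr_eucl_norm wq /h; move: (z - q) => u.
  rewrite !(dotvBl, dotvBr, dotvZl, dotvZr) nu1 (dotvC nu).
  by have := sqr_ge0 (dotv u nu); lra.
- by rewrite /w eucl_distDr0 eucl_normN eucl_normZ (unit_normal_norm nu1) mulr1.
Qed.

Lemma hyperplane_normal (A : set pt) q : hyperplane A -> A q ->
  exists2 nu, dotv nu nu = 1 & forall w, A w <-> dotv (w - q) nu = 0.
Proof.
move=> [v [c [v0 ->]]] /= vq.
have n0 : eucl_norm v != 0 by apply: contra_neq v0 => /eucl_norm0_eq0.
exists ((eucl_norm v)^-1 *: v).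
  by rewrite dotvZl dotvZr -sqr_eucl_norm expr2 mulKf// mulVf.
move=> w; rewrite dotvZr dotvBl !(dotvC _ v) vq; split=> [->|/eqP].
  by rewrite subrr mulr0.
by rewrite mulf_eq0 invr_eq0 (negbTE n0)/= subr_eq0 => /eqP.
Qed.

Lemma dist_set_ge (A : set pt) z (c : R) :
  (forall a, A a -> c <= eucl_dist z a) -> (c%:E <= dist_set z A)%E.
Proof.
by move=> cA; apply: le_ereal_inf_tmp => _ [a Aa <-]; rewrite lee_fin cA.
Qed.

Lemma hyperplane_dist_ge (A : set pt) q nu z : dotv nu nu = 1 ->
  (forall w, A w -> dotv (w - q) nu = 0) ->
  forall w, A w -> `|dotv (z - q) nu| <= eucl_dist z w.
Proof.
move=> nu1 Anu w Aw; have <- : dotv (z - w) nu = dotv (z - q) nu.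
  by rewrite -(subrK q z) -addrA -[q - w]opprB addrK dotvBl (Anu w)// subr0.
exact: dotv_unit_le.
Qed.

Lemma hausdorff_flat_normal Om (P : set pt) q r nu : 0 < r ->
  dotv nu nu = 1 -> (forall w, P w <-> dotv (w - q) nu = 0) ->
  ((r^-1)%:E * hausdorff_dist (boundary Om `&` eucl_ball q r)
     (P `&` eucl_ball q r) <= (600^-1)%:E)%E ->
  flat_normal Om q r nu.
Proof.
move=> r0 nu1 Pnu; rewrite lee_pdivrMl// -EFinM ge_max => /andP[bdP Pbd].
split=> // [p bp pq|w wq w0].
  rewrite -lee_fin; apply: le_trans bdP.
  apply: (@le_trans _ _ (dist_set p (P `&` eucl_ball q r))).
    apply: dist_set_ge => w [/Pnu w0 _].
    exact: (@hyperplane_dist_ge [set w | dotv (w - q) nu = 0] q).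
  apply: ereal_sup_ubound; exists p => //; split => //.
  by rewrite /eucl_ball/= eucl_dist_sym.
have : (dist_set w (boundary Om `&` eucl_ball q r) < (r / 300)%:E)%E.
  apply: (@le_lt_trans _ _ (r * 600^-1)%:E); last by rewrite lte_fin; lra.
  apply: le_trans Pbd; apply: ereal_sup_ubound.
  by exists w => //; split; [exact/Pnu | rewrite /eucl_ball/= eucl_dist_sym].
move=> /ereal_inf_lt[_ [p [bp _] <-]]; rewrite lte_fin => wp.
by exists p => //; rewrite eucl_dist_sym ltW.
Qed.

Lemma flat_normalN Om q r nu : flat_normal Om q r nu -> flat_normal Om q r (- nu).
Proof.
move=> [nu1 F1 F2]; split=> [|p bp pq|w wq].
- by rewrite dotvNl dotvNr opprK.
- by rewrite dotvNr normrN F1.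
- by rewrite dotvNr => /eqP; rewrite oppr_eq0 => /eqP; exact: F2.
Qed.

(** Go from [z] to its orthogonal projection on the hyperplane, which stays in the ball, and from
    there to the boundary. *)
Lemma flat_normal_near_boundary Om q r nu z : flat_normal Om q r nu ->
  eucl_dist z q < r ->
  exists2 p, boundary Om p & eucl_dist p z <= `|dotv (z - q) nu| + r / 300.
Proof.
move=> [nu1 _ F2] zq; have [w0 wq wz] := orthogonal_projection z q nu1.
have [p bp pw] := F2 _ (le_lt_trans wq zq) w0.
exists p => //; rewrite -wz addrC.
by apply: le_trans (eucl_dist_triangle (z - dotv (z - q) nu *: nu) _ _) _; rewrite lerD2r.
Qed.

(* The half ball is convex and misses the boundary, which stays below r / 600. *)
Lemma flat_normal_half_ball Om q r nu z z' : 0 < r -> flat_normal Om q r nu ->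
  eucl_dist z q < r -> r / 300 <= dotv (z - q) nu ->
  eucl_dist z' q < r -> r / 300 <= dotv (z' - q) nu -> Om z -> Om z'.
Proof.
move=> r0 [_ F1 _] zq hz zq' hz' Omz; apply: contrapT => nOmz.
have [t t01 bp] := segment_meets_boundary Omz nOmz.
have := F1 _ bp (eucl_dist_line_lt t01 zq zq').
have := dotv_line_ge t01 hz hz'.
rewrite ler_norml => ? /andP[_ ?]; lra.
Qed.

(** A single point of [Om] whose mirror image in [q] lies outside decides both half balls, since
    membership is constant on each; the sign of [nu] is chosen to put [z] on the upper side. *)
Lemma two_sidedP Om q r nu z : 0 < r -> flat_normal Om q r nu ->
  r / 300 <= `|dotv (z - q) nu| -> eucl_dist z q < r -> Om z ->
  ~ Om (q - (z - q)) -> exists nu', two_sided Om q r nu'.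
Proof.
move=> r0; wlog hz : nu / r / 300 <= dotv (z - q) nu.
  move=> wl F; rewrite ler_normr => /orP[hz|hz].
    by apply: (wl nu) => //; exact: le_trans (ler_norm _).
  apply: (wl (- nu)); rewrite ?dotvNr ?normrN//; first exact: flat_normalN.
  by apply: le_trans hz _; rewrite -normrN ler_norm.
move=> F _ zq Omz nOmz; exists nu; split=> // [w wq hw|w wq hw Omw].
  exact: flat_normal_half_ball F _ _ _ _ Omz.
apply: nOmz; apply: (flat_normal_half_ball r0 (flat_normalN F) wq _ _ _ Omw).
- by rewrite dotvNr lerNr.
- by rewrite /eucl_dist addrAC subrr add0r eucl_normN.
- by rewrite dotvNr addrAC subrr add0r dotvNl opprK.
Qed.

(** * Separation from the two components *)

Lemma component_segment (A : set pt) x y :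
  (forall t, 0 <= t <= 1 -> A (line x y t)) -> connected_component A x y.
Proof.
move=> lA; apply: (connected_component_max _ _ (@segment_line_connected _ _ x y)).
- by exists 0; rewrite ?line0//= in_itv/= lexx ler01.
- by move=> _ [t + <-]; rewrite /= in_itv/=; exact: lA.
- by exists 1; rewrite ?line1//= in_itv/= lexx ler01.
Qed.

(** The ball without the slab is the union of two convex caps, containing [q + r / 2 *: nu] and its
    mirror image. Every component is that of one of these points, so the distinct [C1] and [C2] are
    one each and [two_sidedP] applies. *)
Lemma components_two_sided Om (P C1 C2 : set pt) q r nu : 0 < r ->
  flat_normal Om q r nu -> (forall w, P w <-> dotv (w - q) nu = 0) ->
  C1 <> C2 ->
  components (eucl_ball q r `&`
    [set y | ((2 * 600^-1 * r)%:E <= dist_set y P)%E]) = [set C1; C2] ->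
  C1 `<=` Om -> C2 `<=` ~` Om -> exists nu', two_sided Om q r nu'.
Proof.
move=> r0 F Pnu C12; set S := _ `&` _ => compS C1Om C2Om.
have [nu1 _ _] := F.
have SE y : S y <-> eucl_dist y q < r /\ r / 300 <= `|dotv (y - q) nu|.
  rewrite /S /eucl_ball/= eucl_dist_sym; split=> -[yq hy]; split=> //.
    rewrite -lee_fin; apply: le_trans (le_trans hy _).
      by rewrite lee_fin; lra.
    have [w0 _ wy] := orthogonal_projection y q nu1.
    apply: ereal_inf_lbound; exists (y - dotv (y - q) nu *: nu).
      exact/Pnu.
    by rewrite eucl_dist_sym wy.
  apply: dist_set_ge => w Pw.
  apply: (@le_trans _ _ (r / 300)); first lra.
  by apply: le_trans hy (hyperplane_dist_ge _ nu1 _ Pw) => {w Pw} w /Pnu.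
pose top (s : R) : pt := q + s *: nu.
have topq s : eucl_dist (top s) q = `|s|.
  by rewrite /top eucl_distDr0 eucl_normZ (unit_normal_norm nu1) mulr1.
have toph s : dotv (top s - q) nu = s.
  by rewrite /top addrAC subrr add0r dotvZl nu1 mulr1.
have upper y : eucl_dist y q < r -> r / 300 <= dotv (y - q) nu ->
    connected_component S (top (r / 2)) y.
  move=> yq hy; apply: component_segment => t t01; apply/SE; split.
    apply: eucl_dist_line_lt => //.
    by rewrite topq ger0_norm ?divr_ge0 ?ltW//; lra.
  apply: le_trans (ler_norm _); apply: dotv_line_ge => //.
  by rewrite toph; lra.
have lower y : eucl_dist y q < r -> dotv (y - q) nu <= - (r / 300) ->
    connected_component S (top (- (r / 2))) y.
  move=> yq hy; apply: component_segment => t t01; apply/SE; split.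
    apply: eucl_dist_line_lt => //.
    by rewrite topq normrN ger0_norm ?divr_ge0 ?ltW//; lra.
  rewrite -normrN -dotvNr; apply: le_trans (ler_norm _).
  by apply: dotv_line_ge => //; rewrite dotvNr ?toph; lra.
have compE C : components S C -> C = connected_component S (top (r / 2)) \/
    C = connected_component S (top (- (r / 2))).
  move=> [y /SE[yq +] <-]; rewrite ler_normr => /orP[hy|hy]; [left|right].
    exact/esym/same_connected_component/upper.
  by apply/esym/same_connected_component/lower => //; lra.
have top_bound s : `|s| = r / 2 -> eucl_dist (top s) q < r.
  by rewrite topq => ->; lra.
have r2 : 0 <= r / 2 by lra.
have Stop s : `|s| = r / 2 -> connected_component S (top s) (top s).
  move=> sr; apply: connected_component_refl; apply/SE.
  by split; [exact: top_bound | rewrite toph sr; lra].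
have mirror s : q - (top s - q) = top (- s).
  by rewrite /top addrAC subrr add0r scaleNr.
have finish s : `|s| = r / 2 -> C1 = connected_component S (top s) ->
    C2 = connected_component S (top (- s)) -> exists nu', two_sided Om q r nu'.
  move=> sr C1E C2E; apply: (@two_sidedP _ _ _ nu (top s)) => //.
  - by rewrite toph sr; lra.
  - exact: top_bound.
  - by apply: C1Om; rewrite C1E; exact: Stop.
  - by rewrite mirror; apply: C2Om; rewrite C2E; apply: Stop; rewrite normrN.
have c1 : components S C1 by rewrite compS; left.
have c2 : components S C2 by rewrite compS; right.
have [C1E|C1E] := compE _ c1; have [C2E|C2E] := compE _ c2.
- by case: C12; rewrite C1E.
- by apply: (finish (r / 2)); rewrite ?ger0_norm.
- by apply: (finish (- (r / 2))); rewrite ?opprK ?normrN ?ger0_norm.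
- by case: C12; rewrite C1E.
Qed.

(** * Separation at all smaller scales *)

Lemma two_sided_smaller_scale Om q r r' nu nu' : 0 < r' -> r / 2 <= r' ->
  r' <= r -> two_sided Om q r nu -> flat_normal Om q r' nu' ->
  exists nu'', two_sided Om q r' nu''.
Proof.
move=> r0 rr' r'r [[nu1 F1 _] up low] F'.
(* If z and its mirror image were both too close to the new hyperplane to be
   compared with it, a boundary point near z would violate flatness at scale r. *)
pose z : pt := q + (r' / 2) *: nu.
have zqE : z - q = (r' / 2) *: nu by rewrite /z addrAC subrr add0r.
have zq : eucl_dist z q = r' / 2.
  by rewrite /eucl_dist zqE eucl_normZ (unit_normal_norm nu1) mulr1 ger0_norm ?divr_ge0 ?ltW.
have hz : dotv (z - q) nu = r' / 2 by rewrite zqE dotvZl nu1 mulr1.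
have Omz : Om z by apply: up; rewrite ?zq ?hz; lra.
have nOmz : ~ Om (q - (z - q)).
  apply: low; last by rewrite addrAC subrr add0r dotvNl hz; lra.
  by rewrite eucl_distDr0 eucl_normN -/(eucl_dist z q) zq; lra.
have zq' : eucl_dist z q < r' by rewrite zq; lra.
have [hz'|hz'] := leP (r' / 300) `|dotv (z - q) nu'|.
  exact: two_sidedP F' hz' zq' Omz nOmz.
have [p bp pz] := flat_normal_near_boundary F' zq'.
have pq : eucl_dist p q < r.
  by apply: le_lt_trans (eucl_dist_triangle z _ _) _; rewrite zq; lra.
(* Now [p] is within [r' / 150] of [z] and has height at most [r / 600 <= r' / 300], which
   contradicts the height [r' / 2] of [z]. *)
have := F1 p bp pq; have := dotv_unit_le z p nu1; rewrite eucl_dist_sym.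
have -> : z - p = (z - q) - (p - q) by rewrite opprB addrA subrK.
rewrite dotvBl hz !ler_norml => /andP[_ ?] /andP[_ ?]; lra.
Qed.

Lemma Reifenberg_flat_two_sided Om (r0 : R) : Reifenberg_flat 600^-1 r0 Om ->
  forall q r, boundary Om q -> 0 < r -> r <= r0 ->
  exists nu, two_sided Om q r nu.
Proof.
move=> [_ r0_gt0 _ _ [P [flat sides]]].
have normal q r : boundary Om q -> 0 < r -> r <= r0 ->
    exists2 nu, flat_normal Om q r nu & forall w, P q r w <-> dotv (w - q) nu = 0.
  move=> bq r_gt0 rr0; have [|hP Pq hd] := flat q r bq; first by rewrite r_gt0.
  have [nu nu1 Pnu] := hyperplane_normal hP Pq; exists nu => //.
  exact: hausdorff_flat_normal Pnu hd.
(* Condition (ii) covers only [r = r0]. A smaller scale inherits the separation from one at most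
   twice as large, hence the induction on dyadic ranges of [r]. *)
suff scale n q r : boundary Om q -> r0 / 2 ^+ n <= r -> r <= r0 ->
    exists nu, two_sided Om q r nu.
  move=> q r bq r_gt0 rr0.
  apply: (scale (Num.bound (r0 / r))) => //.
  rewrite ler_pdivrMr ?exprn_gt0// mulrC -ler_pdivrMr//.
  apply: le_trans (ltW (archi_boundP _)) _; first by rewrite divr_ge0 ?ltW.
  by rewrite -natrX ler_nat ltnW// ltn_expl.
elim: n r => [|n IH] r bq rn rr0.
  have -> : r = r0 by rewrite expr0 divr1 in rn; lra.
  have [nu F Pnu] := normal q r0 bq r0_gt0 (lexx _).
  have [C1 [C2 [C12 compS C1Om C2Om]]] := sides q bq.
  exact: components_two_sided F Pnu C12 compS C1Om C2Om.
have [|rn'] := leP (r0 / 2 ^+ n) r; first by move=> ?; exact: IH.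
have rnE : r0 / 2 ^+ n.+1 = r0 / 2 ^+ n / 2 by rewrite exprSr invfM mulrA.
have rn_gt0 : 0 < r0 / 2 ^+ n by rewrite divr_gt0 ?exprn_gt0.
have rnr0 : r0 / 2 ^+ n <= r0.
  by rewrite ler_pdivrMr ?exprn_gt0// ler_peMr ?exprn_ege1 ?ler1n// ltW.
have [nu two] := IH _ bq (lexx _) rnr0.
have r_gt0 : 0 < r by lra.
have [nu' F' _] := normal q r bq r_gt0 rr0.
by apply: two_sided_smaller_scale two F' => //; lra.
Qed.

(** * Distance to the complement versus height over the hyperplane *)

Lemma clearance_mem Om z (c : R) : 0 < c -> clearance Om z c -> Om z.
Proof.
move=> c0 cz; apply: contrapT => /cz; rewrite eucl_distxx; lra.
Qed.

Lemma clearanceW Om z (c c' : R) :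
  c' <= c -> clearance Om z c -> clearance Om z c'.
Proof. by move=> cc' cz a /cz; exact: le_trans. Qed.

Lemma clearance_shift Om z z' (c : R) :
  clearance Om z c -> clearance Om z' (c - eucl_dist z z').
Proof.
by move=> cz a /cz ca; have := eucl_dist_triangle z' z a; lra.
Qed.

(** A point closer than [c] to [z] is still in the ball and at height at least [r / 300], hence in
    [Om]. *)
Lemma two_sided_clearance Om q r nu z (c : R) : two_sided Om q r nu ->
  eucl_dist z q + c <= r -> c + r / 300 <= dotv (z - q) nu -> clearance Om z c.
Proof.
move=> [[nu1 _ _] up _] zq hz a nOma; rewrite leNgt; apply/negP => za.
apply: nOma; apply: up.
  by have := eucl_dist_triangle z a q; rewrite (eucl_dist_sym a z); lra.
have := dotv_unit_le z a nu1.
have -> : z - a = (z - q) - (a - q) by rewrite opprB addrA subrK.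
by rewrite dotvBl ler_norml => /andP[_ ?]; lra.
Qed.

Lemma two_sided_line_clearance Om q r nu x y (B c : R) :
  two_sided Om q r nu -> eucl_dist x q <= B -> eucl_dist y q <= B ->
  B + c <= r -> c + r / 300 <= dotv (x - q) nu ->
  c + r / 300 <= dotv (y - q) nu ->
  forall t, 0 <= t <= 1 -> clearance Om (line x y t) c.
Proof.
move=> two xB yB Bc xh yh t t01; apply: (two_sided_clearance two).
  by have := eucl_dist_line_le t01 xB yB; lra.
exact: dotv_line_ge.
Qed.

(** Some boundary point is within the absolute height of [a] plus [r / 300], so this height is at
    least [c - r / 300 > r / 300]; a negative sign would put [a] outside [Om]. *)
Lemma two_sided_height Om q r nu a (c : R) : open Om -> two_sided Om q r nu ->
  eucl_dist a q < r -> clearance Om a c -> r / 150 < c -> 0 < r ->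
  c - r / 300 <= dotv (a - q) nu.
Proof.
move=> oOm [F _ low] aq ca rc r0.
have Oma : Om a by apply: clearance_mem ca; lra.
have [p bp pa] := flat_normal_near_boundary F aq.
have := ca p (open_boundaryN oOm bp); rewrite eucl_dist_sym => cp.
have [h0|h0] := leP 0 (dotv (a - q) nu).
  by rewrite ger0_norm// in pa; lra.
rewrite ltr0_norm// in pa.
by exfalso; apply: (low a) => //; lra.
Qed.

(** * Climbing away from the boundary through doubling scales *)

(* The construction yields clearance (1/2 - 1/300) r; the weaker factor 49/100
   also admits x itself, whose boundary point q is only nearly closest. *)
Definition high_point Om q a r :=
  eucl_dist a q <= r / 2 /\ clearance Om a (49 / 100 * r).

(** A twisted cone with vertex [x]: the room around [z] grows linearly with the distance from [x],
    up to a radius comparable to [S]. *)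
Definition cone Om x (S : R) z :=
  eucl_dist z x <= 3 / 2 * S /\ clearance Om z (eucl_dist z x / 4).

Section Chains.
Variables (Om : set pt) (r0 : R).
Hypotheses (openOm : open Om) (two : forall q r, boundary Om q -> 0 < r ->
  r <= r0 -> exists nu, two_sided Om q r nu).

Lemma high_point_double q a r : boundary Om q -> 0 < r -> 2 * r <= r0 ->
  high_point Om q a r -> exists a', [/\ high_point Om q a' (2 * r),
    eucl_dist a a' <= 3 / 2 * r &
    forall t, 0 <= t <= 1 -> eucl_dist (line a a' t) q <= r /\
      clearance Om (line a a' t) (2 / 5 * r)].
Proof.
move=> bq r_gt0 rr0 [aq ca].
have [|nu T] := two bq _ rr0; first lra.
have [[nu1 _ _] _ _] := T.
(* At scale [2 * r] the height lost is [2 * r / 300], and [49 / 100 - 2 / 300 > 48 / 100]. *)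
have ah : 48 / 100 * r <= dotv (a - q) nu.
  have := two_sided_height openOm T _ ca; lra.
pose a' : pt := q + r *: nu.
have a'q : eucl_dist a' q = r.
  by rewrite /a' eucl_distDr0 eucl_normZ (unit_normal_norm nu1) mulr1 ger0_norm ?ltW.
have a'h : dotv (a' - q) nu = r.
  by rewrite /a' addrAC subrr add0r dotvZl nu1 mulr1.
exists a'; split.
- by split; [lra | apply: (two_sided_clearance T); lra].
- have := eucl_dist_triangle q a a'; rewrite (eucl_dist_sym q); lra.
- move=> t t01; split; first by apply: eucl_dist_line_le => //; lra.
  by apply: (@two_sided_line_clearance _ _ _ _ a a' r _ T) => //; lra.
Qed.

Lemma high_point_chain x q (r : R) n : boundary Om q -> 0 < r ->
  high_point Om q x r -> r * 2 ^+ n <= r0 ->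
  exists2 a, high_point Om q a (r * 2 ^+ n) &
    lip_path (cone Om x (r * 2 ^+ n)) (3 / 2 * (r * 2 ^+ n)) x a.
Proof.
move=> bq r_gt0 hx; elim: n => [|n IH] rn.
  rewrite expr0 mulr1; exists x => //.
  apply: lip_path_widen (_ : lip_path _ (eucl_dist x x) x x).
    by rewrite eucl_distxx; lra.
  apply: lip_path_line => t _.
  have -> : line x x t = x by rewrite /line subrr scaler0 addr0.
  split; rewrite eucl_distxx; first lra.
  by rewrite mul0r => a _; exact: eucl_dist_ge0.
set s := r * 2 ^+ n in IH *.
have sE : r * 2 ^+ n.+1 = 2 * s by rewrite exprS mulrCA.
have rs : r <= s by rewrite ler_peMr ?exprn_ege1 ?ler1n// ltW.
rewrite sE in rn *.
have [|a ha pa] := IH; first lra.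
have [|a' [ha' aa' la']] := high_point_double bq _ rn ha; first lra.
exists a' => //.
(* The new step is as long as the bound for all earlier ones together, so the bound doubles with the
   scale. *)
have -> : 3 / 2 * (2 * s) = 3 / 2 * s + 3 / 2 * s by ring.
apply: (@lip_path_cat _ _ _ _ _ _ a).
  by apply: lip_path_sub pa => z [? ?]; split => //; lra.
apply: lip_path_widen aa' _; apply: lip_path_line => t t01.
have [lq lc] := la' t t01.
have [xq _] := hx.
have lx : eucl_dist (line a a' t) x <= 3 / 2 * s.
  by have := eucl_dist_triangle q (line a a' t) x; rewrite (eucl_dist_sym q x); lra.
(* The cone opening [1 / 4] suffices: a quarter of [3 / 2 * s] is [3 / 8 * s], below the available
   [2 / 5 * s]. *)
by split; [lra | apply: clearanceW lc; lra].
Qed.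

(** The segment from [x] to a nearly closest point of the complement crosses the boundary at [q];
    openness of [Om] makes the infimum of distances, and with it the scale [s], positive. *)
Lemma near_boundary_high_point x (D : R) : Om x -> ~ clearance Om x D ->
  exists q s, [/\ boundary Om q, 0 < s, s <= 202 / 100 * D,
    eucl_dist x q <= 101 / 100 * D & high_point Om q x s].
Proof.
move=> Omx ncx.
pose E := [set eucl_dist x a | a in ~` Om].
have [a0 nOma0 a0D] : exists2 a, ~ Om a & eucl_dist x a < D.
  apply: contrapT => H; apply: ncx => a nOma; rewrite leNgt; apply/negP => xa.
  by apply: H; exists a.
have E0 : E !=set0 by exists (eucl_dist x a0); exists a0.
have lbE : lbound E 0 by move=> _ [a _ <-]; exact: eucl_dist_ge0.
have hE : has_inf E by split => //; exists 0.
have cinf : clearance Om x (inf E).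
  by move=> a nOma; apply: ge_inf; [exists 0 | exists a].
have [e e0 eOm] := open_eucl_ball openOm Omx.
have inf0 : 0 < inf E.
  apply: lt_le_trans e0 _; apply: lb_le_inf => // _ [a nOma <-].
  by rewrite leNgt; apply/negP => /eOm.
have infD : inf E <= D by apply: le_trans (cinf a0 nOma0) (ltW a0D).
have [|_ [a nOma <-] xa] := @inf_adherent _ E (inf E / 100) _ hE; first lra.
have [t /andP[t0 t1] bq] := segment_meets_boundary Omx nOma.
have xq : eucl_dist x (line x a t) <= 101 / 100 * inf E.
  rewrite -{1}(line0 x a) eucl_dist_line sub0r normrN ger0_norm//.
  have : t * eucl_dist x a <= eucl_dist x a.
    by rewrite ler_piMl ?eucl_dist_ge0.
  lra.
move: xq cinf inf0 infD {hE}; set d := inf E => xq cinf inf0 infD.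
(* This scale is twice the bound on the distance from [x] to [q], while [49 / 100 * 202 / 100 < 1]
   keeps the required clearance below [d]. *)
exists (line x a t), (202 / 100 * d); split => //; [lra..|].
by split; [lra | apply: clearanceW cinf; lra].
Qed.

Lemma approach x (D : R) : Om x -> 0 < D -> 7 * D <= r0 ->
  ~ clearance Om x (11 / 10 * D) ->
  exists q S a, [/\ boundary Om q, eucl_dist x q <= 112 / 100 * D,
    11 / 10 * D <= S <= 23 / 10 * D, high_point Om q a S &
    lip_path (cone Om x S) (3 / 2 * S) x a].
Proof.
move=> Omx D0 Dr0 ncx.
have [q [s [bq s0 sD xq hx]]] := near_boundary_high_point Omx ncx.
have ex : exists n, 11 / 10 * D <= s * 2 ^+ n.
  exists (Num.bound (11 / 10 * D / s)).
  rewrite [s * _]mulrC -ler_pdivrMr//.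
  apply: le_trans (ltW (archi_boundP _)) _; first by rewrite divr_ge0 ?ltW//; lra.
  by rewrite -natrX ler_nat ltnW// ltn_expl.
case: (ex_minnP ex) => n nD nmin.
have nD' : s * 2 ^+ n <= 23 / 10 * D.
  (* Without doubling, [s] is at most [202 / 100 * 11 / 10 * D]; otherwise the preceding scale is
     below [11 / 10 * D], so the last one is below [22 / 10 * D]. *)
  case: n nD nmin => [|n] nD nmin; first by rewrite expr0 mulr1; lra.
  have : s * 2 ^+ n < 11 / 10 * D.
    by rewrite ltNge; apply/negP => /nmin; rewrite ltnn.
  rewrite exprS mulrCA; lra.
have [|a ha pa] := @high_point_chain x q s n bq s0 hx; first lra.
exists q, (s * 2 ^+ n), a; split => //; first lra.
by rewrite nD nD'.
Qed.

(** * Curves satisfying the Jones condition *)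

Definition Jones_point x y z := clearance Om z
  (450^-1 * (eucl_dist z x * eucl_dist z y / eucl_dist x y)).

Lemma Jones_point_sym x y z : Jones_point x y z -> Jones_point y x z.
Proof.
by rewrite /Jones_point (eucl_dist_sym y x) (mulrC (eucl_dist z y)).
Qed.

Lemma Jones_pointP x y z (c : R) : clearance Om z c -> 0 < eucl_dist x y ->
  eucl_dist z x * eucl_dist z y <= 450 * c * eucl_dist x y -> Jones_point x y z.
Proof.
move=> cz D0 H; apply: clearanceW cz.
have : eucl_dist z x * eucl_dist z y / eucl_dist x y <= 450 * c.
  by rewrite ler_pdivrMr.
by move: (_ / _) => t; lra.
Qed.

(** Moving by at most [D] along the segment leaves clearance [D / 10], while the product of the
    distances to the ends is at most [D ^+ 2]. *)
Lemma segment_Jones_path x y : clearance Om x (11 / 10 * eucl_dist x y) ->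
  lip_path (Jones_point x y) (450 * eucl_dist x y) x y.
Proof.
move=> cx; set D := eucl_dist x y.
have D0 : 0 <= D := eucl_dist_ge0 x y.
apply: lip_path_widen (_ : lip_path _ D x y); first lra.
apply: lip_path_line => t t01; set z := line x y t.
have zx : eucl_dist z x <= D.
  by apply: eucl_dist_line_le; rewrite ?eucl_distxx// eucl_dist_sym.
have zy : eucl_dist z y <= D by apply: eucl_dist_line_le; rewrite ?eucl_distxx.
have cz : clearance Om z (D / 10).
  by apply: clearanceW (clearance_shift z cx); rewrite -/D (eucl_dist_sym x); lra.
(* For [D = 0] the quotient is 0 by the convention on inverses, and the bound is trivial. *)
have [DE|DN] := eqVneq D 0.
  move=> a _; rewrite -/D DE invr0 !mulr0; exact: eucl_dist_ge0.
apply: Jones_pointP cz _ _; first by rewrite lt_neqAle eq_sym DN.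
rewrite -/D; have := eucl_dist_ge0 z x; have := eucl_dist_ge0 z y; nra.
Qed.

(** The distance from [z] to [y] is at most [(3 / 2 * 23 / 10 + 1) * D], and the cone supplies a
    quarter of the distance to [x]: [450 / 4] exceeds that factor. *)
Lemma cone_Jones_point x y z (S : R) : 0 < eucl_dist x y ->
  S <= 23 / 10 * eucl_dist x y -> cone Om x S z -> Jones_point x y z.
Proof.
move=> D0 SD [zS cz]; apply: Jones_pointP cz D0 _.
have := eucl_dist_triangle x z y; have := eucl_dist_ge0 z x; nra.
Qed.

Lemma Jones_path x y : Om x -> Om y -> eucl_dist x y <= r0 / 7 ->
  lip_path (Jones_point x y) (450 * eucl_dist x y) x y.
Proof.
move=> Omx Omy; set D := eucl_dist x y => Dr0.
have DE : eucl_dist y x = D by rewrite eucl_dist_sym.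
have [cx|ncx] := pselect (clearance Om x (11 / 10 * D)).
  exact: segment_Jones_path.
have [cy|ncy] := pselect (clearance Om y (11 / 10 * D)).
  apply: lip_path_rev; apply: lip_path_sub (@Jones_point_sym y x) _.
  by rewrite -DE; apply: segment_Jones_path; rewrite DE.
have D0 : 0 < D.
  rewrite ltNge; apply/negP => D0; apply: ncx => a _.
  by apply: le_trans (eucl_dist_ge0 x a); lra.
have D7 : 7 * D <= r0 by lra.
have [q [S [a [bq xq /andP[DS SD] [aq ca] pa]]]] := approach Omx D0 D7 ncx.
have [q' [S' [b [_ yq' /andP[DS' SD'] [bq' cb] pb]]]] := approach Omy D0 D7 ncy.
(* The scale [7 * D] is large enough for the ball around [q] to contain both end points, which lie
   within [9 / 2 * D] of [q], with room for clearance [2 / 5 * D]. *)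
have [|nu T] := two bq _ D7; first lra.
have bx : eucl_dist b x <= 33 / 10 * D.
  have := eucl_dist_triangle q' b x; have := eucl_dist_triangle y q' x.
  rewrite (eucl_dist_sym q' y) DE; lra.
have {}bq : eucl_dist b q <= 9 / 2 * D.
  by have := eucl_dist_triangle x b q; lra.
have aq9 : eucl_dist a q <= 9 / 2 * D by lra.
(* The clearance is at least [49 / 100 * 11 / 10 * D], and the loss is only [7 * D / 300]. The same
   holds for [b], although it was built over [q']. *)
have ha : 1 / 2 * D <= dotv (a - q) nu.
  have := two_sided_height openOm T _ ca; lra.
have hb : 1 / 2 * D <= dotv (b - q) nu.
  have := two_sided_height openOm T _ cb; lra.
have pab : lip_path (Jones_point x y) (6 * D) a b.
  apply: lip_path_widen (_ : lip_path _ (eucl_dist a b) a b).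
    have := eucl_dist_triangle q a b; rewrite (eucl_dist_sym q b); lra.
  apply: lip_path_line => t t01; set z := line a b t.
  have cz : clearance Om z (2 / 5 * D).
    by apply: (@two_sided_line_clearance _ _ _ _ a b _ _ T aq9 bq) => //; lra.
  have zq : eucl_dist z q <= 9 / 2 * D by exact: eucl_dist_line_le.
  have zx : eucl_dist z x <= 6 * D.
    by have := eucl_dist_triangle q z x; rewrite (eucl_dist_sym q x); lra.
  have zy : eucl_dist z y <= 7 * D.
    by have := eucl_dist_triangle x z y; rewrite -/D; lra.
  apply: Jones_pointP cz D0 _; rewrite -/D.
  have := eucl_dist_ge0 z x; have := eucl_dist_ge0 z y; nra.
apply: (@lip_path_widen _ _ _ (3 / 2 * S + (6 * D + 3 / 2 * S'))); first lra.
apply: (@lip_path_cat _ _ _ _ _ _ a).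
  by apply: lip_path_sub pa => z; exact: cone_Jones_point.
apply: lip_path_cat pab _; apply: lip_path_rev; apply: lip_path_sub pb => z cz.
by apply/Jones_point_sym/(cone_Jones_point _ _ cz); rewrite DE.
Qed.

End Chains.

End ReifenbergFlat.

(** Boundedness belongs to the definition of Jones-flat domains but not to that of Reifenberg-flat
    ones, which include half spaces. The curve condition is therefore asserted for every such
    domain, and Jones-flatness for the bounded ones. *)
Theorem theorem2 (R : realType) (N : nat) (r0 : R) (Omega : set 'rV[R]_N)
    (r0_gt0 : 0 < r0) (flat : Reifenberg_flat (600^-1) r0 Omega) :
  Jones_curve_condition (450^-1) (r0 / 7) Omega /\
  (bounded_set Omega -> Jones_flat (450^-1) (r0 / 7) Omega).
Proof.
have [_ _ _ openOm _] := flat.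
have Jones : Jones_curve_condition 450^-1 (r0 / 7) Omega.
  move=> x y Omx Omy xy.
  have [gamma [rect len Jz]] := lip_path_rectifiable
    (Jones_path openOm (Reifenberg_flat_two_sided flat) Omx Omy xy).
  exists gamma; split => // [|z /Jz]; first by rewrite invrK.
  exact: dist_set_ge.
by split=> // bounded; split.
Qed.
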